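(* Let $m\ge 2$ be an even integer, $n=2^m$, $k=2^{m-1}$, $d=2^{m/2}$, and let $G\in\mathbb{F}_2^{k\times n}$ be the generator matrix of an HL-code of length $n$ (determined by a maximal complement-free family $Y$), with row $0$ equal to $v_0=(1,\ldots,1)$. Let $a=(a_0,a_1,\ldots,a_{k-1})\in\mathbb{F}_2^k$ be an arbitrary binary vector, and let $x=a\cdot G+e$ be the codeword modified by an arbitrary vector $e\in\mathbb{F}_2^n$ with $\mathrm{wt}(e)\le\lfloor\frac{d-1}{2}\rfloor$. If $\mathrm{wt}(a_0v_0+e)>\frac n2$, then $a_0=1$, while if $\mathrm{wt}(a_0v_0+e)<\frac n2$, then $a_0=0$.
   Context: $\mathrm{wt}$ denotes Hamming weight. HL-codes. Let $m$ be even, $n=2^m$, and index the coordinates of vectors in $\mathbb{F}_2^n$ by $c\in\{0,\ldots,n-1\}$. Let $v_0=(1,\ldots,1)\in\mathbb{F}_2^n$, and for $1\le i\le m$ let $v_i\in\mathbb{F}_2^n$ be the vector whose coordinate at $c$ is the $i$-th least significant bit of the binary expansion of $c$. For $J\subseteq\{1,\ldots,m\}$ let $v_J=\prod_{i\in J}v_i$ be the coordinatewise product, with $v_\emptyset=v_0$. A maximal complement-free family is a family $Y$ of $\frac m2$-element subsets of $\{1,\ldots,m\}$ with $|Y|=\frac12\binom{m}{m/2}$ such that $J\in Y$ implies $\{1,\ldots,m\}\setminus J\notin Y$. The generator matrix $G$ of the HL-code determined by $Y$ has as rows the vectors $v_J$ for all $J$ with $|J|<\frac m2$ and for all $J\in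 Y$; there are $k=2^{m-1}$ rows, numbered $0,\ldots,k-1$ in order of nondecreasing $|J|$, so row $0$ is $v_0$. The code has length $2^m$, dimension $2^{m-1}$ and minimum distance $d=2^{m/2}$. *)

(* Defs.v *)
From mathcomp Require Import all_boot all_order all_algebra.
Set Implicit Arguments.
Unset Strict Implicit.
Unset Printing Implicit Defensive.
Import GRing.Theory.
Local Open Scope ring_scope.

Definition wt (n : nat) (v : 'rV['F_2]_n) : nat := #|[set c | v 0 c != 0]|.

Definition v0 (m : nat) : 'rV['F_2]_(2 ^ m) := const_mx 1.

(* The index set {1, ..., m} is represented by 'I_m, so [i : 'I_m] stands for
   the index i + 1 and [vbit i] reads the bit of weight 2 ^ i of c. *)
Definition vbit (m : nat) (i : 'I_m) : 'rV['F_2]_(2 ^ m) :=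
  \row_c (odd (c %/ 2 ^ i))%:R.

Definition vset (m : nat) (J : {set 'I_m}) : 'rV['F_2]_(2 ^ m) :=
  \row_c \prod_(i in J) vbit i 0 c.

Lemma vset0 (m : nat) : vset (set0 : {set 'I_m}) = v0 m.
Proof. by apply/rowP => c; rewrite !mxE big_set0. Qed.

(* The cardinality condition |Y| = 'C(m, m/2) / 2 is written without division. *)
Definition maximal_complement_free (m : nat) (Y : {set {set 'I_m}}) : Prop :=
  [/\ forall J, J \in Y -> #|J| = m./2,
      (2 * #|Y|)%N = 'C(m, m./2)
    & forall J, J \in Y -> ~: J \notin Y].

Definition HL_sets (m : nat) (Y : {set {set 'I_m}}) : {set {set 'I_m}} :=
  [set J : {set 'I_m} | (#|J| < m./2)%N || (J \in Y)].

(* The order of rows with the same |J| is not prescribed, so being a generator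
   matrix is a predicate: [f] is the numbering of the rows. *)
Definition HL_generator_matrix (m : nat) (Y : {set {set 'I_m}})
    (G : 'M['F_2]_(2 ^ m.-1, 2 ^ m)) : Prop :=
  exists f : 'I_(2 ^ m.-1) -> {set 'I_m},
    [/\ injective f,
        f @: [set: 'I_(2 ^ m.-1)] = HL_sets Y,
        forall i j : 'I_(2 ^ m.-1), (i <= j)%N -> (#|f i| <= #|f j|)%N
      & forall i, row i G = vset (f i)].

Definition idx0 (m : nat) : 'I_(2 ^ m.-1) := Ordinal (expn_gt0 2 m.-1).

Lemma HL_row0 (m : nat) (Y : {set {set 'I_m}})
    (G : 'M['F_2]_(2 ^ m.-1, 2 ^ m)) :
  (2 <= m)%N -> HL_generator_matrix Y G -> row (idx0 m) G = v0 m.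
Proof.
move=> m_ge2 [f [_ fY f_mono ->]]; rewrite -vset0; congr vset.
have: set0 \in HL_sets Y by rewrite inE cards0 half_gt0 m_ge2.
rewrite -fY => /imsetP[j _ fj]; apply/eqP.
by rewrite -cards_eq0 -leqn0 -(cards0 'I_m) [in leqRHS]fj f_mono.
Qed.

(* Main.v *)
(* Adding v_0 complements a vector, and wt(e) < d/2 <= n/2; so wt(a_0 v_0 + e)
   is below n/2 when a_0 = 0 and above n/2 when a_0 = 1. *)
Require Import Defs.
From mathcomp Require Import all_boot all_order all_algebra.
From mathcomp Require Import zify.
Import GRing.Theory.
Local Open Scope ring_scope.

(** Over ['F_2], adding the all-ones vector flips every coordinate, so the weights of [e] and
    [v0 m + e] sum to n ([wt_v0D]). The error bound puts the first strictly below n/2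
    ([double_wt_error_lt]), hence the second strictly above, and the side of n/2 reveals a_0. *)

Lemma F2_eq0_or1 (b : 'F_2) : b = 0 \/ b = 1.
Proof.
by case: b => [[|[|//]] lt_b2]; [left | right]; apply/val_inj.
Qed.

Lemma F2_add1_neq0 (b : 'F_2) : (1 + b != 0) = ~~ (b != 0).
Proof. by case: (F2_eq0_or1 b) => ->. Qed.

Lemma wt_v0D (m : nat) (e : 'rV['F_2]_(2 ^ m)) :
  (wt (v0 m + e)%R + wt e = 2 ^ m)%N.
Proof.
rewrite /wt; set E := [set c | e 0 c != 0].
have -> : [set c | (v0 m + e) 0 c != 0] = ~: E.
  by apply/setP => c; rewrite !inE !mxE F2_add1_neq0.
by rewrite addnC cardsC card_ord.
Qed.

(** With d = 2^(m/2) > 0, the bound gives 2w <= d - 1 < d <= 2^m. *)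
Lemma double_wt_error_lt (m w : nat) :
  (w <= (2 ^ m./2 - 1) %/ 2 -> 2 * w < 2 ^ m)%N.
Proof.
move=> w_le; have d_gt0 : (0 < 2 ^ m./2)%N by rewrite expn_gt0.
have d_le_n : (2 ^ m./2 <= 2 ^ m)%N by rewrite leq_exp2l // leq_half_double; lia.
lia.
Qed.

Theorem theorem3p3 (m : nat) (Y : {set {set 'I_m}})
    (G : 'M['F_2]_(2 ^ m.-1, 2 ^ m))
    (a : 'rV['F_2]_(2 ^ m.-1)) (e x : 'rV['F_2]_(2 ^ m)) :
  (2 <= m)%N -> ~~ odd m ->
  maximal_complement_free Y ->
  HL_generator_matrix Y G ->
  (wt e <= (2 ^ m./2 - 1) %/ 2)%N ->
  x = a *m G + e ->
  ((2 ^ m %/ 2 < wt (a 0 (idx0 m) *: v0 m + e)%R)%N -> a 0 (idx0 m) = 1) /\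
  ((wt (a 0 (idx0 m) *: v0 m + e)%R < 2 ^ m %/ 2)%N -> a 0 (idx0 m) = 0).
Proof.
move=> _ _ _ _ /double_wt_error_lt wt_lt _.
have wt_compl := wt_v0D m e.
(* For each value of a_0 one implication is trivial and the other has a contradictory premise. *)
case: (F2_eq0_or1 (a 0 (idx0 m))) => ->.
  rewrite scale0r add0r ltn_divLR // mulnC; split => // gt_half.
  by have := ltn_trans gt_half wt_lt; rewrite ltnn.
rewrite scale1r leq_divRL //; split => // lt_half.
(* Two complementary weights cannot both be below n/2. *)
have wt_sum_lt : (2 * (wt (v0 m + e)%R + wt e) < 2 ^ m + 2 ^ m)%N.
  rewrite mulnDr -addSn leq_add 1?ltnW // mulnC.
  by rewrite (leq_trans _ lt_half) // ltn_pmul2r.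
by rewrite wt_compl mul2n addnn ltnn in wt_sum_lt.
Qed.
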